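(* Let $f,g\colon\{1,\dots,m\}\to\{1,\dots,n\}$ be two maps and let $a_i,b_i,c_i\in\mathbb{R}$ for $i\in\{1,\dots,m\}$ be such that $$P:=\bigcap_{i\in\{1,\dots,m\}}\bigl\{x\in\mathbb{R}^n: a_ix_{f(i)}+b_ix_{g(i)}\ge c_i\bigr\}\neq\emptyset.$$ Then $P\subset l_\infty^n$ is injective. Moreover, if $\mathrm{int}(P)\neq\emptyset$, then for every $p\in\partial P$, the convex polyhedral cone $K:=\mathrm{T}_pP-p$ has the property that there is a facet $F\in\mathrm{Facets}^*([-1,1]^n,K)$ with $-F\notin\mathrm{Facets}^*([-1,1]^n,K)$.
   Context: $l_\infty^n$ denotes $\mathbb{R}^n$ endowed with the metric induced by the maximum norm $\|\cdot\|_\infty$; subsets of $l_\infty^n$ carry the induced metric. A metric space $X$ is called injective if for any metric spaces $A,B$, any isometric embedding $i\colon A\to B$ and any $1$-Lipschitz (i.e. distance nonincreasing) map $h\colon A\to X$, there is a $1$-Lipschitz map $k\colon B\to X$ with $k\circ i=h$. For a nonempty convex polyhedron $P\subset\mathbb{R}^n$ (finite intersection of closed half-spaces, with the empty intersection being $\mathbb{R}^n$) and $p\in P$, the tangent cone is $\mathrm{T}_pP:=\bigcup_{m\in\mathbb{N}}\bigl(p+m(P-p)\bigr)$; the set $\mathrm{T}_pP-p$ is a convex polyhedral cone (a convex polyhedron closed under multiplication by scalars $\lambda\ge0$). For a subset $S\subset\mathbb{R}^n$, $\mathrm{Facets}^*([-1,1]^n,S)$ is the set of facets ($(n-1)$-dimensional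 faces) $F$ of the cube $[-1,1]^n$ with $\mathrm{relint}(F)\cap S\neq\emptyset$, where $\mathrm{relint}$ denotes relative interior. $\mathrm{int}$ and $\partial$ denote topological interior and boundary in $\mathbb{R}^n$. *)

(* Defs.v *)
From HB Require Import structures.
From mathcomp Require Import all_boot all_order all_algebra.
From mathcomp Require Import all_classical all_reals all_analysis.

Set Implicit Arguments.
Unset Strict Implicit.
Unset Printing Implicit Defensive.

Import Order.TTheory GRing.Theory Num.Theory.
Import numFieldNormedType.Exports.

Local Open Scope classical_set_scope.
Local Open Scope ring_scope.

(* The library's norm on matrices is the maximum norm, so that 'rV[R]_n with
   the metric below is l_infty^n. *)
Section matrix_metric.
Context (K : numFieldType) (m n : nat).
Implicit Types x y : 'M[K]_(m, n).

Let dist x y : K := `|x - y|.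

Let dist_ge0 x y : 0 <= dist x y.
Proof. exact: normr_ge0. Qed.

Let dist_positivity x y : dist x y = 0 -> x = y.
Proof. by move/normr0_eq0/eqP; rewrite subr_eq0 => /eqP. Qed.

Let ballEdist x d : ball x d = [set y | dist x y < d].
Proof. by rewrite -ball_normE. Qed.

HB.instance Definition _ :=
  PseudoMetric_isMetric.Build K 'M[K]_(m, n)
    dist_ge0 dist_positivity ballEdist.

End matrix_metric.

(* A set [S] used as a type is [{x | x \in S}]; it inherits the metric. *)
Section subset_metric.
Context (R : realType) (X : metricType R) (S : set X).

Let dist (x y : S) : R := mdist (set_val x) (set_val y).

Let dist_ge0 x y : 0 <= dist x y.
Proof. exact: mdist_ge0. Qed.

Let dist_positivity x y : dist x y = 0 -> x = y.
Proof. by move/mdist_positivity/val_inj. Qed.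

Let ballEdist (x : S) d : ball x d = [set y | dist x y < d].
Proof. by rewrite -initial_ballE ballEmdist. Qed.

HB.instance Definition _ :=
  PseudoMetric_isMetric.Build R (set_type S)
    dist_ge0 dist_positivity ballEdist.

End subset_metric.

Section injective_metric_spaces.
Context (R : realType).

Definition isometric_embedding (A B : metricType R) (i : A -> B) : Prop :=
  forall x y, mdist (i x) (i y) = mdist x y.

(* The library's [k.-lipschitz] is restricted to normed modules. *)
Definition lipschitz1 (A B : metricType R) (h : A -> B) : Prop :=
  forall x y, mdist (h x) (h y) <= mdist x y.

Definition injective_space (X : metricType R) : Prop :=
  forall (A B : metricType R) (i : A -> B) (h : A -> X),
    isometric_embedding i -> lipschitz1 h ->
    exists2 k : B -> X, lipschitz1 k & k \o i = h.

End injective_metric_spaces.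

Definition boundary (T : topologicalType) (S : set T) : set T :=
  closure S `\` S°.

Section polyhedra.
Context (R : realType) (n : nat).
Local Notation V := 'rV[R]_n.
Implicit Types (S C F : set V).

Definition two_variable_polyhedron (m : nat) (f g : 'I_m -> 'I_n)
    (a b c : 'I_m -> R) : set V :=
  \bigcap_(i in [set: 'I_m])
    [set x | a i * x ord0 (f i) + b i * x ord0 (g i) >= c i].

Definition tangent_cone S (p : V) : set V :=
  \bigcup_(k in [set: nat]) [set p + k%:R *: (x - p) | x in S].

Definition affine_hull S : set V :=
  [set y | exists (k : nat) (w : 'I_k -> R) (x : 'I_k -> V),
    [/\ forall i, S (x i), \sum_i w i = 1 & y = \sum_i w i *: x i]].

(* [has_dim set0 d] is false for every d, as an affine hull of dimension d is
   nonempty. *)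
Definition has_dim S (d : nat) : Prop :=
  exists (x : V) (U : {vspace V}),
    affine_hull S = [set x + u | u in [set` U]] /\ \dim U = d.

Definition relint S : set V :=
  [set x | S x /\ within (affine_hull S) (nbhs x) S].

(* Faces are the intersections with supporting hyperplanes; the choice u = 0
   makes C a face of itself. *)
Definition is_face C F : Prop :=
  exists (u : V) (t : R),
    (forall x, C x -> \sum_j u ord0 j * x ord0 j <= t) /\
    F = C `&` [set x | \sum_j u ord0 j * x ord0 j = t].

(* Dimension n - 1 is phrased as d.+1 = n, so that there are no facets for
   n = 0. *)
Definition is_facet C F : Prop :=
  is_face C F /\ exists2 d : nat, has_dim F d & d.+1 = n.

Definition cube : set V := [set x | forall j, -1 <= x ord0 j <= 1].

Definition facets_star C S : set (set V) :=
  [set F | is_facet C F /\ relint F `&` S !=set0].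

End polyhedra.

Arguments cube : clear implicits.

(* Main.v *)
Require Import Defs.
From mathcomp Require Import all_boot all_order all_algebra.
From mathcomp Require Import all_classical all_reals all_analysis.
From mathcomp Require Import finmap ring lra.
Import Order.TTheory GRing.Theory Num.Theory.
Import numFieldNormedType.Exports.
Local Open Scope classical_set_scope.
Local Open Scope ring_scope.

Set Implicit Arguments.
Unset Strict Implicit.
Unset Printing Implicit Defensive.

(** Both halves rest on one feature of inequalities in two variables: they
    are preserved by the coordinatewise median of three points.  Among three
    points, at least two satisfy [a * x k <= a * m k], where [m] is the
    median, and at least two satisfy [b * x l <= b * m l]; some point does
    both, and its inequality passes to [m] ([median_closed_two_variable]).
    A set [P] closed under medians has a Helly property ([median_Helly]):
    finitely many sets that are convex for the median and meet pairwise inside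
    [P] have a common point in [P].

    Injectivity.  Balls of the maximum norm are boxes, hence convex for the
    median.  If the centres lie in [P] and the centre distances are at most
    the sums of the radii, then two balls meet on the segment of their
    centres, which lies in [P] as [P] is convex.  So the Helly property and
    compactness give a point of [P] common to all the balls: [P] is hyperconvex
    ([median_hyperconvex]).  The theorem of Aronszajn and Panitchpakdi
    ([hyperconvex_injective]) then extends 1-Lipschitz maps one point at a
    time, by Zorn's lemma.

    Facets.  The cone [K] at [p] is cut out by the homogeneous constraints
    that are active at [p] ([tangent_cone_two_variable]), so it is again closed
    and closed under medians.  Let [e] be interior to [K].  Then [- e] is not
    in [K]: otherwise [K] would be the whole space and [p] interior to [P].
    Hence the point [x] of least norm in [e + K] is not [0].  It is interior to
    [K], so for each coordinate [k] with [`|x k| = `|x|], increasing [`|x k|]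
    slightly and rescaling gives a point of [K] inside the facet of the cube
    where the [k]-th coordinate is the sign of [x k].  If [K] also met the
    relative interior of each opposite facet, it would contain points [v_k] with
    [v_k k] the opposite sign and all other coordinates less than 1 in absolute
    value.  In [v_k + v_l] both the [k]-th and the [l]-th coordinates have the
    opposite sign, so that the Helly property, applied to half-spaces, provides
    one [v] in [K] with sign opposite to [x] in all the maximal coordinates.
    Then [x + s *: v], still in [e + K], has smaller norm than [x] for small
    [s > 0], a contradiction ([cone_one_sided_facet]). *)

(** * The maximum norm *)

Lemma le_mx_norm_coord (R : realType) n (x : 'rV[R]_n) j : `|x ord0 j| <= `|x|.
Proof.
rewrite [leRHS]/Num.Def.normr /= mx_normrE; apply/bigmax_geP; right.
by exists (ord0, j).
Qed.

Lemma mx_norm_le (R : realType) n (x : 'rV[R]_n) r :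
  0 <= r -> (forall j, `|x ord0 j| <= r) -> `|x| <= r.
Proof.
move=> r0 xr; rewrite [leLHS]/Num.Def.normr /= mx_normrE.
by apply: bigmax_le => // -[i j] _; rewrite /= (ord1 i).
Qed.

Lemma mx_norm_lt (R : realType) n (x : 'rV[R]_n) r :
  0 < r -> (forall j, `|x ord0 j| < r) -> `|x| < r.
Proof.
move=> r0 xr; rewrite [ltLHS]/Num.Def.normr /= mx_normrE.
by apply: bigmax_lt => // -[i j] _; rewrite /= (ord1 i).
Qed.

Lemma nbhs_rowP (R : realType) n (x : 'rV[R]_n) (A : set 'rV[R]_n) :
  nbhs x A <-> exists2 d : R, 0 < d & forall y, `|x - y| < d -> A y.
Proof. exact: (nbhs_normP x A). Qed.

(** * Medians *)

Section median.
Context (R : realType) (n : nat).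
Implicit Types (s t u : R) (x y z : 'rV[R]_n) (C P : set 'rV[R]_n).

Definition median s t u : R := Num.max (Num.min s t) (Num.min (Num.max s t) u).

(** Turns every statement about [median] into a linear case analysis. *)
Lemma medianE s t u : median s t u =
  if s <= t then (if u <= s then s else if t <= u then t else u)
  else (if u <= t then t else if s <= u then s else u).
Proof. by rewrite /median /Order.max /Order.min; do ! case: ifP => //; lra. Qed.

Lemma medianC s t u : median s t u = median t s u.
Proof. by rewrite !medianE; do ! case: ifP => //; lra. Qed.

Lemma medianAC s t u : median s t u = median s u t.
Proof. by rewrite !medianE; do ! case: ifP => //; lra. Qed.

(** Negative scalars swap [min] and [max]; the median formula is self-dual. *)
Lemma medianZ k s t u : k * median s t u = median (k * s) (k * t) (k * u).
Proof.
have [k0|k0] := leP 0 k.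
  by rewrite /median maxr_pMr// !minr_pMr// maxr_pMr.
rewrite /median maxr_nMr ?minr_nMr ?maxr_nMr ?ltW// /Order.max /Order.min.
by do ! case: ifP => //; lra.
Qed.

Definition row_median x y z : 'rV[R]_n :=
  \row_j median (x ord0 j) (y ord0 j) (z ord0 j).

Lemma row_medianC x y z : row_median x y z = row_median y x z.
Proof. by apply/rowP => j; rewrite !mxE medianC. Qed.

Lemma row_medianAC x y z : row_median x y z = row_median x z y.
Proof. by apply/rowP => j; rewrite !mxE medianAC. Qed.

(** In the terms of median algebras, [median_closed] defines subalgebras and
    [median_convex] defines convex sets. *)
Definition median_closed P :=
  forall x y z, P x -> P y -> P z -> P (row_median x y z).

Definition median_convex C := forall x y z, C x -> C y -> C (row_median x y z).

Lemma median_closedI P C :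
  median_closed P -> median_convex C -> median_closed (P `&` C).
Proof.
by move=> PM CM x y z [Px Cx] [Py Cy] [Pz _]; split; [exact: PM|exact: CM].
Qed.

(** Three sets that meet pairwise in [x], [y], [z] all contain the median of
    these points, as each contains two of them.  Hence replacing [P] by
    [P `&` C i] keeps the other sets pairwise intersecting, and induction on
    the number of sets applies. *)
Lemma median_Helly (I : eqType) (C : I -> set 'rV[R]_n) P (s : seq I) :
  median_closed P -> P !=set0 -> (forall i, i \in s -> median_convex (C i)) ->
  (forall i j, i \in s -> j \in s -> P `&` C i `&` C j !=set0) ->
  exists2 x, P x & forall i, i \in s -> C i x.
Proof.
elim: s P => [|i s IHs] P PM [p Pp] CM PCC; first by exists p.
have CMi : median_convex (C i) by apply: CM; rewrite mem_head.
have sub k : k \in s -> k \in i :: s by rewrite inE orbC => ->.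
have [||k ks|j k js ks|x [Px Cix] Csx] := IHs (P `&` C i).
- exact: median_closedI.
- by have [x [? ?]] := PCC i i (mem_head _ _) (mem_head _ _); exists x.
- by apply: CM; exact: sub.
- have [x [[Px Cix] Cjx]] := PCC i j (mem_head _ _) (sub _ js).
  have [y [[Py Ciy] Cky]] := PCC i k (mem_head _ _) (sub _ ks).
  have [z [[Pz Cjz] Ckz]] := PCC j k (sub _ js) (sub _ ks).
  exists (row_median x y z); split; [split; [split|]|].
  + exact: PM.
  + exact: CMi.
  + by rewrite row_medianAC; apply: (CM j (sub _ js)).
  + by rewrite row_medianC row_medianAC; apply: (CM k (sub _ ks)).
- by exists x => // k; rewrite inE => /predU1P[->|/Csx].
Qed.

(** Being within distance [r] of [x] is a condition on each coordinate
    separately, namely to lie in an interval. *)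
Lemma median_convex_ball x r : median_convex [set z | `|z - x| <= r].
Proof.
move=> y z t /= yx zx; have r0 : 0 <= r := le_trans (normr_ge0 _) yx.
apply: mx_norm_le => // j.
have := le_trans (le_mx_norm_coord _ j) yx.
have := le_trans (le_mx_norm_coord _ j) zx.
rewrite !mxE !ler_norml medianE => /andP[? ?] /andP[? ?].
by apply/andP; do ! case: ifP => //; lra.
Qed.

Lemma median_convex_halfspace k j : median_convex [set z | 0 < k * z ord0 j].
Proof.
move=> y z t /=; rewrite mxE medianZ medianE => y0 z0.
by do ! case: ifP => //; lra.
Qed.

(** The two scaled coordinates of the median each dominate at least two of the
    three corresponding values, so some point is dominated in both. *)
Lemma median_closed_two_variable m (f g : 'I_m -> 'I_n) (a b c : 'I_m -> R) :
  median_closed (two_variable_polyhedron f g a b c).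
Proof.
move=> x y z Px Py Pz i _ /=.
have := Px i I; have := Py i I; have := Pz i I.
rewrite /= !mxE !medianZ !medianE.
by do ! case: ifP => //; lra.
Qed.

End median.

(** * Hyperconvexity and injectivity *)

Definition convex_subset (R : realType) n (C : set 'rV[R]_n) : Prop :=
  forall x y t, C x -> C y -> 0 <= t <= 1 -> C (x + t *: (y - x)).

Lemma two_variable_continuous (R : realType) n (k l : 'I_n) (a b : R) :
  continuous (fun x : 'rV[R]_n => a * x ord0 k + b * x ord0 l).
Proof.
by move=> x; exact: (continuousD
  (cvgMl_tmp (@coord_continuous _ _ _ _ _ x))
  (cvgMl_tmp (@coord_continuous _ _ _ _ _ x))).
Qed.

Lemma closed_two_variable (R : realType) m n (f g : 'I_m -> 'I_n)
    (a b c : 'I_m -> R) : closed (two_variable_polyhedron f g a b c).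
Proof.
apply: closed_bigI => i _.
exact: (preimage_closed
  (fun x _ => @two_variable_continuous R n (f i) (g i) (a i) (b i) x)
  (@closed_ge _ (c i))).
Qed.

Lemma convex_two_variable (R : realType) m n (f g : 'I_m -> 'I_n)
    (a b c : 'I_m -> R) : convex_subset (two_variable_polyhedron f g a b c).
Proof.
move=> x y t Px Py /andP[t0 t1] i _ /=; rewrite !mxE.
have /= := Px i I; have /= := Py i I; nra.
Qed.

Lemma compact_closed_ball (R : realType) n (x : 'rV[R]_n) r :
  compact [set z | `|z - x| <= r].
Proof.
apply: bounded_closed_compact.
  exists (`|x| + r); split; first exact: num_real.
  move=> M /ltW xM z /= zx; rewrite -(subrK x z) (le_trans (ler_normD _ _))//.
  by rewrite (le_trans _ xM)// addrC lerD2l.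
have -> : [set z | `|z - x| <= r] = closed_ball_ Num.norm x r.
  by apply/seteqP; split=> z; rewrite /closed_ball_/= distrC.
exact: closed_closed_ball_.
Qed.

(** [D] lists centres and radii of closed balls. *)
Definition hyperconvex (R : realType) n (P : set 'rV[R]_n) : Prop :=
  forall D : set ('rV[R]_n * R), (forall q, D q -> P q.1) ->
    (forall q q', D q -> D q' -> `|q.1 - q'.1| <= q.2 + q'.2) ->
    exists2 z, P z & forall q, D q -> `|z - q.1| <= q.2.

(** Two of the balls meet inside [P] because [P] contains the segment joining
    their centres; the Helly property handles finite families of balls, and
    compactness of one ball handles infinite ones. *)
Lemma median_hyperconvex (R : realType) n (P : set 'rV[R]_n) :
  median_closed P -> convex_subset P -> closed P -> P !=set0 -> hyperconvex P.
Proof.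
move=> PM PC Pcl [p Pp] D DP DD.
pose C (q : 'rV[R]_n * R) := [set z : 'rV[R]_n | `|z - q.1| <= q.2].
have r0 q : D q -> 0 <= q.2.
  by move=> Dq; have := DD q q Dq Dq; rewrite subrr normr0 -mulr2n pmulrn_lge0.
have meet q q' : D q -> D q' -> P `&` C q `&` C q' !=set0.
  move=> Dq Dq'; have q0 := r0 _ Dq; have q'0 := r0 _ Dq'.
  have qq' := DD _ _ Dq Dq'.
  (* The common point divides the segment in the ratio of the radii; this
     needs a positive sum of radii. *)
  have [r_eq0|r_neq0] := eqVneq (q.2 + q'.2) 0.
    exists q.1; split; [split|]; rewrite /C/=.
    - exact: DP.
    - by rewrite subrr normr0.
    - by rewrite (le_trans qq')// r_eq0.
  have r_gt0 : 0 < q.2 + q'.2 by rewrite lt_def r_neq0 addr_ge0.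
  exists (q.1 + (q.2 / (q.2 + q'.2)) *: (q'.1 - q.1));
    split; [split|]; rewrite /C/=.
  - apply: PC; [exact: DP|exact: DP|].
    by rewrite divr_ge0 ?addr_ge0//= ler_pdivrMr// mul1r lerDl.
  - rewrite addrC addKr normrZ ger0_norm ?divr_ge0 ?addr_ge0// distrC.
    by rewrite mulrAC ler_pdivrMr// ler_wpM2l.
  - rewrite (_ : _ - _ = (q'.2 / (q.2 + q'.2)) *: (q.1 - q'.1)).
      rewrite normrZ ger0_norm ?divr_ge0 ?addr_ge0//.
      by rewrite mulrAC ler_pdivrMr// ler_wpM2l.
    by apply/rowP => j; rewrite !mxE; field.
have [[q0 Dq0]|noD] := pselect (D !=set0); last first.
  by exists p => // q Dq; case: noD; exists q.
have := @compact_closed_ball R n q0.1 q0.2.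
rewrite compact_In0 => /(_ _ D (fun q => C q0 `&` (P `&` C q))) [||z Cz].
- exists (fun q => P `&` C q) => // q Dq; apply: closedI => //.
  exact: compact_closed (@norm_hausdorff _ _) (@compact_closed_ball R n _ _).
- move=> D' D'D.
  have [] := @median_Helly R n _ C P (q0 :: D') PM.
  + by exists p.
  + by move=> q _; exact: median_convex_ball.
  + move=> q q'; rewrite !inE => Dq Dq'; apply: meet.
      by case/predU1P: Dq => [->//|/D'D/set_mem].
    by case/predU1P: Dq' => [->//|/D'D/set_mem].
  move=> z Pz Cz; exists z => q /= qD'.
  split; first by apply: Cz; rewrite mem_head.
  by split=> //; apply: Cz; rewrite inE orbC qD'.
- exists z; first by have [_ []] := Cz _ Dq0.
  by move=> q /Cz[_ []].
Qed.

(** The extension is built as a graph in [B * P], maximal among the relations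
    that stay 1-Lipschitz when joined with the graph [G0] of [h] transported
    along [i].  Joining [G0] afterwards, rather than asking the relation to
    contain it, makes the condition hold for the union of the empty chain.
    A maximal relation is defined at each [y]: a value at [y] is a point common
    to the balls around the values [q.2] with radius the distance from [q.1]
    to [y]. *)
Lemma hyperconvex_injective (R : realType) n (P : set 'rV[R]_n) :
  hyperconvex P -> injective_space P.
Proof.
move=> hypP A B i h iI hL.
pose nonexp (G : set (B * 'rV[R]_n)) := (forall q, G q -> P q.2) /\
  forall q q', G q -> G q' -> `|q.2 - q'.2| <= mdist q.1 q'.1.
pose G0 : set (B * 'rV[R]_n) := [set (i x, set_val (h x)) | x in setT].
have mdistP (x y : P) : mdist x y = `|set_val x - set_val y| by [].
have G0n : nonexp G0.
  split=> [_ [x _ <-]/=|_ _ [x _ <-] [y _ <-]/=]; first exact: set_valP.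
  by rewrite -mdistP iI.
have [F FF|G [Gn Gmax]] := @Zorn_bigcup _ [set G | nonexp (G `|` G0)].
  move=> Ftot; split.
    by move=> q [[X /FF[XP _] Xq]|/G0n.1//]; apply: XP; left.
  move=> q q' [[X FX Xq]|G0q] [[Y FY Yq']|G0q'].
  - have [XY|YX] := Ftot _ _ FX FY.
      by apply: (FF _ FY).2; left => //; exact: XY.
    by apply: (FF _ FX).2; left => //; exact: YX.
  - by apply: (FF _ FX).2; [left|right].
  - by apply: (FF _ FY).2; [right|left].
  - exact: G0n.2.
have Gtot y : exists z, (G `|` G0) (y, z).
  have [||z Pz zD] := hypP [set (q.2, mdist q.1 y) | q in G `|` G0].
  - by move=> _ [q Gq <-]; exact: Gn.1.
  - move=> _ _ [q Gq <-] [q' Gq' <-] /=.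
    rewrite (le_trans (Gn.2 _ _ Gq Gq'))// (le_trans (metric_triangle _ y _))//.
    by rewrite (metric_sym y).
  have zG q : (G `|` G0) q -> `|z - q.2| <= mdist y q.1.
    by move=> Gq; rewrite metric_sym; apply: (zD (q.2, mdist q.1 y)); exists q.
  exists z; apply: contrapT => nGz.
  apply: (Gmax (G `|` [set (y, z)])).
    split; first by move=> ?; left.
    by move=> /(_ (y, z)) sub; apply: nGz; left; apply: sub; right.
  have cases q : (G `|` [set (y, z)] `|` G0) q -> (G `|` G0) q \/ q = (y, z).
    by case=> [[Gq|->]|G0q]; [left; left|right|left; right].
  split=> [q /cases[/Gn.1//|->//]|q q' /cases[Gq|->] /cases[Gq'|->] /=].
  - exact: Gn.2.
  - by rewrite distrC metric_sym zG.
  - exact: zG.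
  - by rewrite subrr normr0 mdist_ge0.
have /choice[k kG] := Gtot.
have kP y : k y \in P by apply: mem_set; exact: (Gn.1 _ (kG y)).
exists (fun y => SigSub (kP y)).
  by move=> x y; rewrite mdistP; exact: (Gn.2 _ _ (kG x) (kG y)).
apply/funext => x /=; apply/val_inj => /=; apply/eqP.
rewrite -subr_eq0 -normr_le0.
have G0x : (G `|` G0) (i x, set_val (h x)) by right; exists x.
by rewrite (le_trans (Gn.2 _ _ (kG (i x)) G0x))//= mdistxx.
Qed.

(** * Median-closed cones and the facets of the cube *)

(** For [`|s| = 1], the relative interior of a facet of the cube. *)
Definition open_facet (R : realType) n (k : 'I_n) (s : R) : set 'rV[R]_n :=
  [set x | x ord0 k = s /\ forall j, j != k -> `|x ord0 j| < 1].

(** After a push by [d] along the [k]-th axis away from [0], the [k]-th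
    coordinate is the only one of maximal absolute value; rescaling moves the
    point onto the facet. *)
Lemma cone_meets_open_facet (R : realType) n (K : set 'rV[R]_n) (x : 'rV[R]_n)
    (k : 'I_n) (d : R) :
  (forall t y, 0 <= t -> K y -> K (t *: y)) -> 0 < d ->
  K (x + d *: (Num.sg (x ord0 k) *: delta_mx ord0 k)) ->
  `|x ord0 k| = `|x| -> 0 < `|x| ->
  K `&` open_facet k (Num.sg (x ord0 k)) !=set0.
Proof.
move=> KZ d0 Ky xk x0; set y := (X in K X) in Ky.
have r0 : 0 < `|x| + d by rewrite addr_gt0.
exists ((`|x| + d)^-1 *: y); split; first by apply: KZ; rewrite // invr_ge0 ltW.
split=> [|j jk]; rewrite !mxE !eqxx /=.
  rewrite mulr1 mulrC {1}[x ord0 k]numEsg xk.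
  by apply: (mulIf (lt0r_neq0 r0)); rewrite divfK ?lt0r_neq0//; ring.
rewrite (negbTE jk) !mulr0 addr0 normrM gtr0_norm ?invr_gt0//.
rewrite mulrC ltr_pdivrMr// mul1r.
by rewrite (le_lt_trans (le_mx_norm_coord _ j))// ltrDl.
Qed.

(** Coordinates of maximal absolute value shrink to first order, and the other
    ones have room to move. *)
Lemma norm_decrease (R : realType) n (x v : 'rV[R]_n) :
  0 < `|x| ->
  (forall k, `|x ord0 k| = `|x| -> x ord0 k * v ord0 k < 0) ->
  exists2 s, 0 < s & `|x + s *: v| < `|x|.
Proof.
move=> x0 xv.
have bound j : exists2 e : R, 0 < e &
    forall s, 0 < s < e -> `|x ord0 j + s * v ord0 j| < `|x|.
  have v0 : 0 < `|v ord0 j| + 1 by rewrite ltr_wpDl.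
  have ltv : `|v ord0 j| < `|v ord0 j| + 1 by rewrite ltrDl.
  have [xj|xj] := eqVneq `|x ord0 j| `|x|.
    exists (`|x| / (`|v ord0 j| + 1)); first by rewrite divr_gt0.
    move=> s /andP[s0]; rewrite ltr_pdivlMr// => sv; have := xv _ xj.
    move: sv x0; rewrite -xj normr_gt0 [in X in _ -> _ -> _ -> X]ltr_norml.
    case: (ltrgt0P (x ord0 j)) => // xj0; case: (ltrgt0P (v ord0 j)) => vj0;
      by move=> *; apply/andP; split; nra.
  exists ((`|x| - `|x ord0 j|) / (`|v ord0 j| + 1)).
    by rewrite divr_gt0// subr_gt0 lt_neqAle xj le_mx_norm_coord.
  move=> s /andP[s0]; rewrite ltr_pdivlMr// => sv.
  rewrite (le_lt_trans (ler_normD _ _))// normrM (gtr0_norm s0) addrC -ltrBrDr.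
  by rewrite (lt_trans _ sv)// ltr_pM2l.
have [s [s0 sP]] : exists s, 0 < s /\
    forall j, `|x ord0 j + s * v ord0 j| < `|x|.
  near (0 : R)^'+ => s; exists s; split; first by [].
  near: s; apply: filter_forall => j; have [e e0 eP] := bound j.
  near=> s; apply: eP; apply/andP; split; first by [].
  by near: s; exact: nbhs_right_lt.
by exists s => //; apply: mx_norm_lt => // j; rewrite !mxE.
Unshelve. all: by end_near. Qed.

(** Otherwise a point of least norm in [e + K] could be improved: [K] would
    contain a vector whose sign is opposite in all the maximal coordinates. *)
Lemma cone_one_sided_facet (R : realType) n (K : set 'rV[R]_n) (e : 'rV[R]_n)
    (d : R) :
  closed K -> median_closed K ->
  (forall x y, K x -> K y -> K (x + y)) ->
  (forall t x, 0 <= t -> K x -> K (t *: x)) ->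
  0 < d -> (forall u, `|u| < d -> K (e + u)) -> ~ K (- e) ->
  exists k s, [/\ `|s| = 1, K `&` open_facet k s !=set0 &
    ~ (K `&` open_facet k (- s) !=set0)].
Proof.
move=> Kcl KM KD KZ d0 Ke KNe; apply: contrapT => noF.
have both k s : `|s| = 1 -> K `&` open_facet k s !=set0 ->
    K `&` open_facet k (- s) !=set0.
  by move=> s1 hit; apply: contrapT => nhit; apply: noF; exists k, s.
have K0 : K 0.
  by rewrite -(scale0r (e + 0)); apply: KZ => //; apply: Ke; rewrite normr0.
(* The competitors can be restricted to the norm ball through [e], which is
   compact. *)
have [x Kx xmin] : exists2 x, K (x - e) & forall y, K (y - e) -> `|x| <= `|y|.
  pose A := [set x : 'rV[R]_n | K (x - e)] `&` [set x | `|x - 0| <= `|e|].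
  have Acl : closed [set x : 'rV[R]_n | K (x - e)].
    have shift : continuous (fun x : 'rV[R]_n => x - e).
      by move=> x; exact: (cvgB cvg_id (cvg_cst e)).
    exact: (preimage_closed (fun x _ => shift x) Kcl).
  have [|||x] := @EVT_min_rV R n Num.norm A.
  - by exists e; split; rewrite /= ?subrr ?subr0.
  - apply: (subclosed_compact _ (@compact_closed_ball R n 0 `|e|)).
      apply: closedI => //.
      exact: compact_closed (@norm_hausdorff _ _)
        (@compact_closed_ball R n _ _).
    by move=> x [].
  - by apply: continuous_subspaceT; exact: norm_continuous.
  move=> /set_mem[Kx]; rewrite /= subr0 => xe xmin; exists x => // y Ky.
  have [ye|/ltW ey] := leP `|y| `|e|; last exact: le_trans ey.
  by apply: xmin; apply: mem_set; split; rewrite /= ?subr0.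
have x0 : 0 < `|x|.
  by rewrite normr_gt0; apply/eqP => x0; move: Kx; rewrite x0 sub0r.
pose M := [seq k <- enum 'I_n | `|x ord0 k| == `|x|].
have MP k : k \in M -> `|x ord0 k| = `|x|.
  by rewrite mem_filter => /andP[/eqP].
(* [x] is interior to [K], so [K] meets the facet on the side of [x], hence
   also the opposite one. *)
have opp k : `|x ord0 k| = `|x| ->
    K `&` open_facet k (- Num.sg (x ord0 k)) !=set0.
  move=> xk; apply: both.
    by rewrite normr_sg -normr_eq0 xk gt_eqF.
  apply: (@cone_meets_open_facet _ _ _ _ _ (d / 2)) => //.
    by rewrite divr_gt0.
  rewrite -(subrK e x) -addrA; apply: KD => //; apply: Ke.
  apply: mx_norm_lt => // j; rewrite !mxE eqxx /= subrK.
  have [_|_] := eqVneq j k; last by rewrite !mulr0 normr0.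
  rewrite mulr1 normrM normr_sg -normr_eq0 xk gt_eqF// mulr1.
  by rewrite gtr0_norm ?divr_gt0// ltr_pdivrMr// ltr_pMr// ltrDl.
have [v Kv vM] : exists2 v, K v &
    forall k, k \in M -> 0 < (- x ord0 k) * v ord0 k.
  apply: (@median_Helly _ _ _ (fun k => [set z | 0 < (- x ord0 k) * z ord0 k])).
  - exact: KM.
  - by exists 0.
  - by move=> k _; exact: median_convex_halfspace.
  move=> k l /MP xk /MP xl.
  have [v [Kv [vk vj]]] := opp k xk; have [w [Kw [wl wj]]] := opp l xl.
  (* The vector for [i] can spoil the sign at [j], but by less than [`|x|],
     which is what the vector for [j] contributes there. *)
  have half (y : 'rV[R]_n) j i : `|x ord0 j| = `|x| ->
      y ord0 i = - Num.sg (x ord0 i) ->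
      (forall j, j != i -> `|y ord0 j| < 1) -> - `|x| < - x ord0 j * y ord0 j.
    move=> xj yi yj; have [ji|ji] := eqVneq j i.
      rewrite -ji in yi; rewrite yi mulrNN mulrC -normrEsg xj.
      by rewrite (lt_trans (y := 0))// oppr_lt0.
    rewrite ltrNl mulNr opprK (le_lt_trans (ler_norm _))// normrM xj.
    by rewrite gtr_pMr// yj.
  have self (y : 'rV[R]_n) j : `|x ord0 j| = `|x| ->
      y ord0 j = - Num.sg (x ord0 j) ->
      - x ord0 j * y ord0 j = `|x|.
    by move=> xj ->; rewrite mulrNN mulrC -normrEsg.
  exists (v + w); split; [split|]; rewrite /=.
  - exact: KD.
  - rewrite mxE mulrDr (self v k)//.
    by rewrite -ltrBlDl sub0r (half w k l).
  - rewrite mxE mulrDr (self w l)//.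
    by rewrite -ltrBlDr sub0r (half v l k).
have xv k : `|x ord0 k| = `|x| -> x ord0 k * v ord0 k < 0.
  move=> xk; rewrite -oppr_gt0 -mulNr; apply: vM.
  by rewrite mem_filter xk eqxx mem_enum.
have [s s0] := norm_decrease x0 xv.
rewrite ltNge => /negP; apply; apply: xmin.
by rewrite addrAC; apply: KD => //; apply: KZ => //; exact: ltW.
Qed.

(** * Facets of the cube *)

Definition cube_facet (R : realType) n (k : 'I_n) (s : R) : set 'rV[R]_n :=
  cube R n `&` [set x | x ord0 k = s].

Section cube_facets.
Context (R : realType) (n : nat) (k : 'I_n) (s : R) (s1 : `|s| = 1).
Local Notation F := (cube_facet k s).

(** A point [y] of the hyperplane lies on the line through the centre of the
    facet and a point of the facet, obtained by contracting [y] to the centre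
    by the factor [1 + `|y|]. *)
Lemma affine_hull_cube_facet :
  affine_hull F = [set x : 'rV[R]_n | x ord0 k = s].
Proof.
apply/seteqP; split=> [_ [l [w [x [Fx w1 ->]]]]|y /= yk].
  rewrite /= summxE (eq_bigr (fun i => w i * s)) => [|i _].
    by rewrite -mulr_suml w1 mul1r.
  by rewrite mxE (Fx i).2.
have [c ck c0] : exists2 c : 'rV[R]_n, c ord0 k = s &
    forall j, j != k -> c ord0 j = 0.
  exists (s *: delta_mx ord0 k) => [|j jk]; first by rewrite !mxE !eqxx mulr1.
  by rewrite !mxE (negbTE jk) mulr0.
pose t := 1 + `|y|.
have t0 : 0 < t by rewrite ltr_wpDr.
pose x (i : 'I_2) := if i == ord0 then c else c + t^-1 *: (y - c).
pose w (i : 'I_2) := if i == ord0 then 1 - t else t.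
exists 2%N, w, x; split.
- move=> i; rewrite /x; split; last first.
    by case: ifP => _ //=; rewrite !mxE ck yk subrr mulr0 addr0.
  move=> j; rewrite -ler_norml; have [->|jk] := eqVneq j k.
    case: ifP => _; first by rewrite ck s1.
    by rewrite !mxE ck yk subrr mulr0 addr0 s1.
  case: ifP => _; first by rewrite c0// normr0.
  rewrite !mxE c0// oppr0 addr0 add0r.
  rewrite normrM gtr0_norm ?invr_gt0// mulrC ler_pdivrMr// mul1r.
  by rewrite (le_trans (le_mx_norm_coord _ j))// lerDr.
- by rewrite big_ord_recl big_ord1 /w /= subrK.
- rewrite big_ord_recl big_ord1 /w /x /=.
  apply/rowP => j; rewrite !mxE; field.
  exact: lt0r_neq0.
Qed.

(** The supporting functional is [s] times the [k]-th coordinate; the direction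
    of the affine hull is the kernel of this coordinate, of codimension 1. *)
Lemma is_facet_cube_facet : is_facet (cube R n) F.
Proof.
have ss : s * s = 1 by rewrite -expr2 -real_normK ?num_real// s1 expr1n.
split.
  have sumE (x : 'rV[R]_n) :
      \sum_j (s *: delta_mx ord0 k : 'rV[R]_n) ord0 j * x ord0 j = s * x ord0 k.
    rewrite (bigD1 k)//= big1 ?addr0 => [|j jk].
      by rewrite !mxE !eqxx mulr1.
    by rewrite !mxE (negbTE jk) mulr0 mul0r.
  exists (s *: delta_mx ord0 k), 1; split=> [x xc|].
    by rewrite sumE (le_trans (ler_norm _))// normrM s1 mul1r ler_norml.
  congr (_ `&` _); apply/seteqP; split=> x /=; rewrite sumE;
    [by move=> ->|move=> sx].
  by rewrite -[x ord0 k]mul1r -ss -mulrA sx mulr1.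
have n0 : (0 < n)%N := leq_ltn_trans (leq0n k) (ltn_ord k).
exists n.-1; last by rewrite prednK.
pose c := linfun (col k : 'rV[R]_n -> 'cV[R]_1).
have cE x : (c x == 0) = (x ord0 k == 0).
  rewrite lfunE /=; apply/eqP/eqP => [/matrixP/(_ ord0 ord0)|xk];
    rewrite ?mxE//.
  by apply/matrixP => i j; rewrite !mxE (ord1 i).
exists (s *: delta_mx ord0 k), (lker c); split.
  rewrite affine_hull_cube_facet; apply/seteqP; split=> [x /= xk|_ [u + <-]].
    exists (x - s *: delta_mx ord0 k); last by rewrite addrC subrK.
    by rewrite /= memv_ker cE !mxE !eqxx xk mulr1 subrr.
  by rewrite /= memv_ker cE => /eqP uk; rewrite !mxE !eqxx uk mulr1 addr0.
have dimV := limg_ker_dim c fullv.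
have full : (c @: fullv)%VS = fullv.
  apply/eqP; rewrite eqEsubv subvf /=; apply/subvP => y _.
  apply/memv_imgP; exists (y ord0 ord0 *: delta_mx ord0 k); rewrite ?memvf//.
  by rewrite lfunE; apply/matrixP => i j; rewrite !ord1 !mxE !eqxx mulr1.
move: dimV; rewrite capfv full !dimvf !dim_matrix !mul1r => dimn.
by rewrite -[in RHS]dimn addn1.
Qed.

(** A point of the facet with a further coordinate [j] of absolute value 1
    leaves the cube, within the hyperplane, when that coordinate grows. *)
Lemma relint_cube_facet : relint F = open_facet k s.
Proof.
apply/seteqP; split=> x.
  move=> [[xc xk]]; rewrite affine_hull_cube_facet /within => xF.
  split=> // j jk; rewrite lt_neqAle ler_norml xc andbT; apply/negP => /eqP xj.
  have /nbhs_rowP[d d0 dF] := xF.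
  have d20 : 0 < d / 2 by rewrite divr_gt0.
  have [||] := dF (x + (d / 2) *: (x ord0 j *: delta_mx ord0 j)).
  - rewrite opprD addNKr normrN; apply: mx_norm_lt => // i.
    rewrite !mxE eqxx normrM gtr0_norm// normrM xj mul1r.
    case: (i == j); rewrite ?normr1 ?normr0 ?mulr0 ?mulr1//.
    by rewrite ltr_pdivrMr// ltr_pMr// ltrDl.
  - by rewrite /= !mxE eq_sym (negbTE jk) !mulr0 addr0.
  move=> /(_ j) + _; rewrite -ler_norml !mxE !eqxx mulr1.
  rewrite -{1}[x ord0 j]mul1r -mulrDl normrM xj mulr1 gtr0_norm ?ltr_wpDr//.
    by rewrite gerDl leNgt d20.
  exact: ltW.
move=> [xk xj]; split.
  split=> // j; rewrite -ler_norml.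
  by have [->|/xj/ltW//] := eqVneq j k; rewrite xk s1.
rewrite affine_hull_cube_facet /within.
have near1 j : nbhs x [set y : 'rV[R]_n | j != k -> `|y ord0 j| <= 1].
  apply/nbhs_rowP; have [->|jk] := eqVneq j k.
    by exists 1 => // y _ /=; rewrite eqxx.
  exists (1 - `|x ord0 j|) => /=; first by rewrite subr_gt0 xj.
  move=> y xy _; rewrite -[y ord0 j](subrK (x ord0 j)).
  rewrite (le_trans (ler_normD _ _))// -lerBrDr ltW// (le_lt_trans _ xy)//.
  by rewrite -normrN opprB; have := le_mx_norm_coord (x - y) j; rewrite !mxE.
have /nbhs_rowP[d d0 dP] :
    nbhs x [set y : 'rV[R]_n | forall j, j != k -> `|y ord0 j| <= 1].
  exact: filter_forall near1.
apply/nbhs_rowP; exists d => // y /dP yj yk; split=> // j; rewrite -ler_norml.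
by have [->|/yj//] := eqVneq j k; rewrite yk s1.
Qed.

End cube_facets.

Lemma opp_cube_facet (R : realType) n (k : 'I_n) (s : R) :
  [set - x | x in cube_facet k s] = cube_facet k (- s).
Proof.
have sub t : [set - x | x in cube_facet k t] `<=` cube_facet k (- t).
  move=> _ [x [xc xk] <-]; split=> [j|]; rewrite /= mxE ?xk//.
  by rewrite -ler_norml normrN ler_norml.
apply/seteqP; split=> [|x Fx]; first exact: sub.
exists (- x); last by rewrite opprK.
by rewrite -[s]opprK; apply: sub; exists x.
Qed.

(** * Tangent cones *)

Section tangent.
Context (R : realType) (m n : nat) (f g : 'I_m -> 'I_n) (a b c : 'I_m -> R).
Local Notation P := (two_variable_polyhedron f g a b c).
Local Notation form i x := (a i * x ord0 (f i) + b i * x ord0 (g i)).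

(** The constraints inactive at [p] are replaced by [0 >= 0] instead of being
    removed, so that the result is again a [two_variable_polyhedron]. *)
Definition active_polyhedron (p : 'rV[R]_n) : set 'rV[R]_n :=
  let active (d : 'I_m -> R) i := if form i p == c i then d i else 0 in
  two_variable_polyhedron f g (active a) (active b) (fun=> 0).

Lemma active_polyhedronP p v :
  active_polyhedron p v <-> forall i, form i p = c i -> 0 <= form i v.
Proof.
split=> [Kv i /eqP ip|Kv i _ /=]; first by have := Kv i I; rewrite /= ip.
by case: eqP => [/Kv//|_]; rewrite !mul0r addr0.
Qed.

(** Inactive constraints have positive slack at [p], so that [p + k^-1 *: v]
    satisfies them for all large [k]. *)
Lemma tangent_cone_two_variable p : P p ->
  [set x - p | x in tangent_cone P p] = active_polyhedron p.
Proof.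
move=> Pp; apply/seteqP; split=> [_ [_ [k _ [x Px <-]] <-]|v].
  apply/active_polyhedronP => i ip; have /= := Px i I.
  rewrite [p + _]addrC addrK !mxE -ip => xp.
  have -> : a i * (k%:R * (x ord0 (f i) - p ord0 (f i))) +
      b i * (k%:R * (x ord0 (g i) - p ord0 (g i))) =
      k%:R * (form i x - form i p) by ring.
  by rewrite mulr_ge0// subr_ge0.
move=> /active_polyhedronP Kv.
have [k [k0 kv]] : exists k : nat, (0 < k)%N /\
    forall i, form i p != c i -> `|form i v| <= k%:R * (form i p - c i).
  near \oo => k; exists k; split; first by near: k; exact: nbhs_infty_gt.
  near: k; apply: filter_forall => i; have [ip|ip] := eqVneq (form i p) (c i).
    by near=> k.
  have cp : 0 < form i p - c i.
    by rewrite subr_gt0 lt_neqAle eq_sym ip; exact: Pp i I.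
  near=> k => _; rewrite -ler_pdivrMr//.
  by near: k; exact: nbhs_infty_ger.
have k0R : 0 < k%:R :> R by rewrite ltr0n.
exists (p + v); last by rewrite addrC addKr.
exists k => //; exists (p + k%:R^-1 *: v).
  move=> i _ /=; rewrite !mxE.
  have -> : a i * (p ord0 (f i) + k%:R^-1 * v ord0 (f i)) +
      b i * (p ord0 (g i) + k%:R^-1 * v ord0 (g i)) =
      form i p + form i v / k%:R by ring.
  have [ip|ip] := eqVneq (form i p) (c i).
    by rewrite ip lerDl divr_ge0 ?ler0n//; exact: Kv.
  rewrite -lerBlDl ler_pdivlMr// mulrC -opprB mulrN lerNl.
  by rewrite (le_trans _ (kv i ip))// -normrN ler_norm.
by rewrite [X in k%:R *: X]addrC addKr scalerA divff ?gt_eqF// scale1r.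
Unshelve. all: by end_near. Qed.

(** An active constraint that holds on all of the space cannot cut off points
    near [p], and inactive ones hold near [p] by continuity. *)
Lemma interior_of_active_setT p : P p ->
  (forall v, active_polyhedron p v) -> P° p.
Proof.
move=> Pp Kall.
have near1 i : nbhs p [set x : 'rV[R]_n | c i <= form i x].
  have [ip|ip] := eqVneq (form i p) (c i).
    apply/nbhs_rowP; exists 1 => // x _ /=.
    have /active_polyhedronP/(_ i ip) := Kall (x - p).
    by rewrite !mxE -ip; lra.
  apply: (cvgr_ge _ (@two_variable_continuous R n (f i) (g i) (a i) (b i) p)).
  by rewrite lt_neqAle eq_sym ip; exact: Pp i I.
have /nbhs_rowP[d d0 dP] :
    nbhs p [set x : 'rV[R]_n | forall i, c i <= form i x].
  exact: filter_forall near1.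
by apply/nbhs_rowP; exists d => // x /dP Px i _; exact: Px.
Qed.

End tangent.

(** Translating the ball around [e] by [- e] gives a ball around [0] in [K], and
    its multiples cover the space. *)
Lemma open_cone_opp_setT (R : realType) n (K : set 'rV[R]_n) (e : 'rV[R]_n)
    (d : R) :
  (forall x y, K x -> K y -> K (x + y)) ->
  (forall t x, 0 <= t -> K x -> K (t *: x)) ->
  0 < d -> (forall u, `|u| < d -> K (e + u)) -> K (- e) -> forall v, K v.
Proof.
move=> KD KZ d0 Ke KNe v; pose t := d / (`|v| + 1).
have v0 : 0 < `|v| + 1 by rewrite ltr_wpDl.
have t0 : 0 < t by rewrite divr_gt0.
rewrite -[v](scalerK (lt0r_neq0 t0)); apply: KZ; first by rewrite invr_ge0 ltW.
rewrite -[_ *: _](addKr e); apply: KD => //; apply: Ke.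
rewrite normrZ gtr0_norm// /t mulrAC ltr_pdivrMr// ltr_pM2l//.
by rewrite ltrDl.
Qed.

(** * Injectivity and one-sided facets *)

Theorem corollary1p6 (R : realType) (m n : nat) (f g : 'I_m -> 'I_n)
    (a b c : 'I_m -> R) :
  let P : set 'rV[R]_n := two_variable_polyhedron f g a b c in
  P !=set0 ->
  injective_space P /\
  (P° !=set0 ->
   forall p : 'rV[R]_n, boundary P p ->
     let K := [set x - p | x in tangent_cone P p] in
     exists2 F : set 'rV[R]_n,
       facets_star (cube R n) K F &
       ~ facets_star (cube R n) K [set - x | x in F]).
Proof.
move=> P P0; split.
  apply: hyperconvex_injective; apply: median_hyperconvex => //.
  - exact: median_closed_two_variable.
  - exact: convex_two_variable.
  - exact: closed_two_variable.
move=> [x0 /nbhs_rowP[d d0 dP]] p [/closed_two_variable Pp Pop] /=.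
rewrite tangent_cone_two_variable//; set K := active_polyhedron _ _ _ _ _ p.
have KD x y : K x -> K y -> K (x + y).
  move=> /active_polyhedronP Kx /active_polyhedronP Ky.
  apply/active_polyhedronP => i ip; rewrite !mxE.
  by have := Kx i ip; have := Ky i ip; lra.
have KZ t x : 0 <= t -> K x -> K (t *: x).
  move=> t0 /active_polyhedronP Kx.
  apply/active_polyhedronP => i ip; rewrite !mxE.
  by have := Kx i ip; nra.
have Ke u : `|u| < d -> K ((x0 - p) + u).
  move=> ud; apply/active_polyhedronP => i ip.
  have := dP (x0 + u); rewrite opprD addNKr normrN => /(_ ud) /(_ i I) /=.
  by rewrite !mxE -ip; lra.
have KNe : ~ K (- (x0 - p)).
  move=> KNe; apply: Pop; apply: interior_of_active_setT => //.
  exact: open_cone_opp_setT KD KZ d0 Ke KNe.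
have [||k [s [s1 hit nhit]]] := cone_one_sided_facet _ _ KD KZ d0 Ke KNe.
- exact: closed_two_variable.
- exact: median_closed_two_variable.
exists (cube_facet k s).
  by split; [exact: is_facet_cube_facet|rewrite relint_cube_facet// setIC].
rewrite opp_cube_facet => -[_]; rewrite relint_cube_facet ?normrN//.
by rewrite setIC.
Qed.
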